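(* Let $(X,c)$ be a session coalgebra equipped with a dual function $T\mapsto\overline{T}$. For all contexts $\Gamma_1,\Gamma_2$ and annotated processes $P$: if $\Gamma_1\vdash P;\Gamma_2$ (algorithmic judgement) and $\mathrm{un}(\Gamma_2)$, then $\Gamma_1\vdash\mathit{erase}(P)$ (declarative typing judgement).
   Context: Session coalgebra: fix basic data types $D$ with a decidable preorder $\le_D$ and labels $\mathbb{L}$. A session coalgebra is a set $X$ with $c(x)=(\sigma(x),\delta(x))$, $\sigma(x)$ one of $(\mathrm{com},p)$ ($p\in\{\mathrm{in},\mathrm{out}\}$), $(\mathrm{branch},p,L)$ ($L\subseteq\mathbb{L}$ finite nonempty), $\mathrm{end}$, $(\mathrm{bsc},d)$ ($d\in D$), $\mathrm{par}$; and $\delta(x)\colon B_{\sigma(x)}\to X$ with $B_{(\mathrm{com},p)}=\{*,1\}$, $B_{(\mathrm{branch},p,L)}=L$, $B_{\mathrm{end}}=B_{(\mathrm{bsc},d)}=\emptyset$, $B_{\mathrm{par}}=\{*\}$. Abbreviations: $?=(\mathrm{com},\mathrm{in})$, $!=(\mathrm{com},\mathrm{out})$. Bisimilarity $\sim$: greatest $R\subseteq X\times X$ such that for $(x,y)\in R$ either $\sigma(x)=\sigma(y)$ and $\delta(x)(\alpha)\,R\,\delta(y)(\alpha)$ for all $\alpha$, or $\sigma(x)=(\mathrm{bsc},d),\sigma(y)=(\mathrm{bsc},d')$ with $d\le_D d'\le_D d$. Parallelizability: $\mathrm{par}(x)$ if the least set $Y$ containing $x$ closed under continuation transitions (label $*$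 for com states, all labels otherwise) is closed under all transitions and any $u,w\in Y$ satisfy $u\sim w$, $\sigma(u)=\mathrm{par}$ or $\sigma(w)=\mathrm{par}$. Similarity $\sqsubseteq$: greatest $R$ such that each $(x,y)\in R$ satisfies one of: both $?$ with $\delta(x)( * )R\delta(y)( * )$, $\delta(x)(1)R\delta(y)(1)$; both $!$ with $\delta(x)( * )R\delta(y)( * )$, $\delta(y)(1)R\delta(x)(1)$; $(\mathrm{branch},\mathrm{in},L_1)$ vs $(\mathrm{branch},\mathrm{in},L_2)$, $L_1\subseteq L_2$, $\delta(x)(l)R\delta(y)(l)$ for $l\in L_1$; $(\mathrm{branch},\mathrm{out},L_1)$ vs $(\mathrm{branch},\mathrm{out},L_2)$, $L_2\subseteq L_1$, $\delta(x)(l)R\delta(y)(l)$ for $l\in L_2$; $(\mathrm{bsc},d)$ vs $(\mathrm{bsc},d')$, $d\le_D d'$; both $\mathrm{end}$; both $\mathrm{par}$ with $\delta(x)( * )R\delta(y)( * )$ and $\mathrm{par}(\delta(x)( * ))$ iff $\mathrm{par}(\delta(y)( * ))$. Duality $\bot$: greatest $R$ such that for $(x,y)\in R$: $\sigma(y)=\overline{\sigma(x)}$ with $\overline{(\mathrm{com},p)}=(\mathrm{com},\overline p)$, $\overline{(\mathrm{branch},p,L)}=(\mathrm{branch},\overline p,L)$, $\overline{\mathrm{end}}=\mathrm{end}$, $\overline{\mathrm{par}}=\mathrm{par}$, $\overline{\mathrm{in}}=\mathrm{out}$ and vice versa (bsc has no dual); continuation successors $R$-related; for com states $\delta(x)(1)\sim\delta(y)(1)$.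 A dual function assigns to states $T$ a state $\overline{T}\in X$ with $T\bot\overline{T}$ (as provided by passing to the dual closure of $X$). Processes: $P,Q::=\overline{x}\langle y\rangle.P\mid x(y).P\mid x\rhd\{l_i:P_i\}_{i\in I}\mid x\lhd l.P\mid P\mid Q\mid\ !P\mid\mathbf{0}\mid(\nu xy)P$. Annotated processes are the same but with $x(y:T).P$ and $(\nu xy:T)P$ ($T\in X$) in place of $x(y).P$ and $(\nu xy)P$; $\mathit{erase}$ removes these annotations homomorphically. Contexts: finite sets of pairs $x:T$ with at most one pair per variable; $\Gamma,x:T$ presupposes $x\notin\mathrm{dom}(\Gamma)$. $\mathrm{un}(T)$ if $\sigma(T)\in\{\mathrm{par},\mathrm{end}\}$ or $\sigma(T)=(\mathrm{bsc},d)$; $\mathrm{un}(\Gamma)$ if all its types are unrestricted. Context split: least relation with $\emptyset=\emptyset\circ\emptyset$ and, from $\Gamma=\Gamma_1\circ\Gamma_2$: $\Gamma,x:T=(\Gamma_1,x:T)\circ(\Gamma_2,x:T)$ if $\mathrm{un}(T)$; $\Gamma,x:T=(\Gamma_1,x:T)\circ\Gamma_2$; $\Gamma,x:T=\Gamma_1\circ(\Gamma_2,x:T)$. Context difference (partial): $\Gamma\div\emptyset=\Gamma$; if $\Gamma_1\div F=\Gamma_2,x:T$ with $\mathrm{un}(T)$ then $\Gamma_1\div(F,x)=\Gamma_2$; if $\Gamma_1\div F=\Gamma_2$ with $x\notin\mathrm{dom}(\Gamma_2)$ then $\Gamma_1\div(F,x)=\Gamma_2$ (so it is undefined if a removed variable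 has a linear type). Declarative typing $\Gamma\vdash P$: (Inact) $\mathrm{un}(\Gamma)\Rightarrow\Gamma\vdash\mathbf{0}$; (Res) $\Gamma,x:T,y:U\vdash P$, $T\bot U\Rightarrow\Gamma\vdash(\nu xy)P$; (Par) $\Gamma_1\vdash P$, $\Gamma_2\vdash Q\Rightarrow\Gamma_1\circ\Gamma_2\vdash P\mid Q$; (Rep) $\Gamma\vdash P$, $\mathrm{un}(\Gamma)\Rightarrow\Gamma\vdash\,!P$; (In) $\sigma(T)=?$, $f=\delta(T)$, $\Gamma,y:U,x:f( * )\vdash P$, $f(1)\sqsubseteq U\Rightarrow\Gamma,x:T\vdash x(y).P$; (Out) $\sigma(T)=!$, $\Gamma,x:f( * )\vdash P$, $U\sqsubseteq f(1)\Rightarrow\Gamma,x:T,y:U\vdash\overline{x}\langle y\rangle.P$; (Branch) $\sigma(T)=(\mathrm{branch},\mathrm{in},L_1)$, $L_1\subseteq L_2$, $\Gamma,x:f(l)\vdash P_l$ for all $l\in L_1\Rightarrow\Gamma,x:T\vdash x\rhd\{l:P_l\}_{l\in L_2}$; (Sel) $\sigma(T)=(\mathrm{branch},\mathrm{out},L)$, $l\in L$, $\Gamma,x:f(l)\vdash P_l\Rightarrow\Gamma,x:T\vdash x\lhd l.P_l$; (Unpack) $\sigma(T)=\mathrm{par}$, $\mathrm{par}(T)$, $\Gamma,x:\delta(T)( * )\vdash P\Rightarrow\Gamma,x:T\vdash P$ (here $f=\delta(T)$). Algorithmic judgement $\Gamma_1\vdash P;\Gamma_2$ (annotated $P$): (A-Inact)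 $\Gamma\vdash\mathbf{0};\Gamma$; (A-Rep) $\Gamma_1\vdash P;\Gamma_2$, $\Gamma_1=\Gamma_2\Rightarrow\Gamma_1\vdash\,!P;\Gamma_2$; (A-Par) $\Gamma_1\vdash P;\Gamma_2$, $\Gamma_2\vdash Q;\Gamma_3\Rightarrow\Gamma_1\vdash P\mid Q;\Gamma_3$; (A-Res) $\Gamma_1,x:T,y:\overline{T}\vdash P;\Gamma_2\Rightarrow\Gamma_1\vdash(\nu xy:T)P;\Gamma_2\div\{x,y\}$; (A-In) $\sigma(T)=?$, $f(1)\sqsubseteq U$, $\Gamma_1,y:U,x:f( * )\vdash P;\Gamma_2\Rightarrow\Gamma_1,x:T\vdash x(y:U).P;\Gamma_2\div\{x,y\}$; (A-Out) $\sigma(T)=!$, $U\sqsubseteq f(1)$, $\Gamma_1,x:f( * )\vdash P;\Gamma_2\Rightarrow\Gamma_1,x:T,y:U\vdash\overline{x}\langle y\rangle.P;\Gamma_2\div\{x\}$; (A-Branch) $\sigma(T)=(\mathrm{branch},\mathrm{in},L_1)$, $L_1\subseteq L_2$, $\Gamma_1,x:f(l)\vdash P_l;\Gamma_l$ for all $l\in L_1$, where all $\Gamma_l\div\{x\}$ are defined and equal $\Rightarrow\Gamma_1,x:T\vdash x\rhd\{l:P_l\}_{l\in L_2};\Gamma_l\div\{x\}$; (A-Sel) $\sigma(T)=(\mathrm{branch},\mathrm{out},L)$, $l\in L$, $\Gamma_1,x:f(l)\vdash P_l;\Gamma_2\Rightarrow\Gamma_1,x:T\vdash x\lhd l.P_l;\Gamma_2\div\{x\}$;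 (A-Unpack) $\sigma(T)=\mathrm{par}$, $\mathrm{par}(T)$, $\Gamma_1,x:\delta(T)( * )\vdash P;\Gamma_2\Rightarrow\Gamma_1,x:T\vdash P;(\Gamma_2\div\{x\}),x:T$ (with $f=\delta(T)$ throughout). *)

(* Defs.v *)
From mathcomp Require Import all_boot.
From mathcomp Require Import finmap.

Set Implicit Arguments.
Unset Strict Implicit.
Unset Printing Implicit Defensive.

Local Open Scope fset_scope.
Local Open Scope fmap_scope.

Inductive polarity := pin | pout.

Definition dual_pol (p : polarity) : polarity :=
  match p with pin => pout | pout => pin end.

Inductive op (D : Type) (lab : choiceType) : Type :=
| Com of polarity
| Branch of polarity & {fset lab}
| End
| Bsc of D
| Par.
Arguments Com {D lab} _.
Arguments Branch {D lab} _ _.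
Arguments End {D lab}.
Arguments Bsc {D lab} _.
Arguments Par {D lab}.

(* Transition labels: the disjoint union of { *, 1 } and the branch labels. *)
Inductive tlabel (lab : Type) : Type := Star | One | Lab of lab.
Arguments Star {lab}.
Arguments One {lab}.
Arguments Lab {lab} _.

(* The set B_o as a decidable subset of the transition labels.  Membership is
   an equation in bool, so membership proofs are unique and a function on B_o
   can be curried over them without ambiguity. *)
Definition arity (D : Type) (lab : choiceType) (o : op D lab)
    (a : tlabel lab) : bool :=
  match o, a with
  | Com _, Star => true
  | Com _, One => true
  | Branch _ L, Lab l => l \in L
  | Par, Star => true
  | _, _ => false
  end.

Definition cont_label (D : Type) (lab : choiceType) (o : op D lab)
    (a : tlabel lab) : bool :=
  match o, a with
  | Com _, Star => true
  | Com _, _ => false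
  | _, _ => arity o a
  end.

Record sessionCoalgebra (D : Type) (lab : choiceType) := SessionCoalgebra {
  state :> Type;
  sigma : state -> op D lab;
  delta : forall (x : state) (a : tlabel lab), arity (sigma x) a -> state;
  branch_nonempty : forall x p L, sigma x = Branch p L -> L != fset0
}.
Arguments sigma {D lab s} _.
Arguments delta {D lab s} _ _ _.

(* The greatest relation R with R <= F R, as the union of all of them; every F
   below is monotone. *)
Definition gfp (X : Type) (F : (X -> X -> Prop) -> X -> X -> Prop) (x y : X)
    : Prop :=
  exists R : X -> X -> Prop, (forall u v, R u v -> F R u v) /\ R x y.

Section Relations.
Variables (D : Type) (leD : rel D) (lab : choiceType).
Variable X : sessionCoalgebra D lab.
Implicit Types (x y u w T U : X) (R : X -> X -> Prop).

Definition bisim_step R x y : Prop :=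
  (sigma x = sigma y /\
     forall a (hx : arity (sigma x) a) (hy : arity (sigma y) a),
       R (delta x a hx) (delta y a hy))
  \/ (exists d d', [/\ sigma x = Bsc d, sigma y = Bsc d', leD d d' & leD d' d]).

Definition bisim : X -> X -> Prop := gfp bisim_step.

Inductive cont_reach x : X -> Prop :=
| cont_reach_refl : cont_reach x x
| cont_reach_step u a (h : arity (sigma u) a) :
    cont_reach x u -> cont_label (sigma u) a -> cont_reach x (delta u a h).

Definition parallelizable x : Prop :=
  (forall u a (h : arity (sigma u) a),
     cont_reach x u -> cont_reach x (delta u a h)) /\
  (forall u w, cont_reach x u -> cont_reach x w ->
     [\/ bisim u w, sigma u = Par | sigma w = Par]).

(* In each clause the equations on sigma x and sigma y make the quantified
   membership proofs exist. *)
Inductive sim_step R x y : Prop :=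
| sim_in of sigma x = Com pin & sigma y = Com pin
    & (forall hx hy, R (delta x Star hx) (delta y Star hy))
    & (forall hx hy, R (delta x One hx) (delta y One hy))
| sim_out of sigma x = Com pout & sigma y = Com pout
    & (forall hx hy, R (delta x Star hx) (delta y Star hy))
    & (forall hx hy, R (delta y One hy) (delta x One hx))
| sim_branch_in L1 L2 of sigma x = Branch pin L1 & sigma y = Branch pin L2
    & L1 `<=` L2
    & (forall l hx hy, l \in L1 -> R (delta x (Lab l) hx) (delta y (Lab l) hy))
| sim_branch_out L1 L2 of sigma x = Branch pout L1 & sigma y = Branch pout L2
    & L2 `<=` L1
    & (forall l hx hy, l \in L2 -> R (delta x (Lab l) hx) (delta y (Lab l) hy))
| sim_bsc d d' of sigma x = Bsc d & sigma y = Bsc d' & leD d d'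
| sim_end of sigma x = End & sigma y = End
| sim_par of sigma x = Par & sigma y = Par
    & (forall hx hy, R (delta x Star hx) (delta y Star hy))
    & (forall hx hy, parallelizable (delta x Star hx)
                     <-> parallelizable (delta y Star hy)).

Definition sim : X -> X -> Prop := gfp sim_step.

(* None: basic types have no dual. *)
Definition dual_op (o : op D lab) : option (op D lab) :=
  match o with
  | Com p => Some (Com (dual_pol p))
  | Branch p L => Some (Branch (dual_pol p) L)
  | End => Some End
  | Bsc _ => None
  | Par => Some Par
  end.

Definition duality_step R x y : Prop :=
  [/\ dual_op (sigma x) = Some (sigma y),
      forall a hx hy, cont_label (sigma x) a -> R (delta x a hx) (delta y a hy)
    & forall p hx hy, sigma x = Com p -> bisim (delta x One hx) (delta y One hy)].

Definition duality : X -> X -> Prop := gfp duality_step.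

(* A dual function is partial because some states (the basic ones at least)
   have no dual at all; a total one is the case where dual T is always Some. *)
Definition dual_function (dual : X -> option X) : Prop :=
  forall T T', dual T = Some T' -> duality T T'.

End Relations.

(* A branching process offers one continuation for each label of a finite set,
   hence the family indexed by the elements of that set. *)
Inductive process (lab var : choiceType) : Type :=
| POut (x y : var) (P : process lab var)
| PIn (x y : var) (P : process lab var)
| PBranch (x : var) (L : {fset lab}) (P : L -> process lab var)
| PSel (x : var) (l : lab) (P : process lab var)
| PPar (P Q : process lab var)
| PRep (P : process lab var)
| PNil
| PRes (x y : var) (P : process lab var).
Arguments PNil {lab var}.
Arguments POut {lab var} _ _ _.
Arguments PIn {lab var} _ _ _.
Arguments PRes {lab var} _ _ _.

Inductive aprocess (lab var : choiceType) (X : Type) : Type :=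
| AOut (x y : var) (P : aprocess lab var X)
| AIn (x y : var) (T : X) (P : aprocess lab var X)
| ABranch (x : var) (L : {fset lab}) (P : L -> aprocess lab var X)
| ASel (x : var) (l : lab) (P : aprocess lab var X)
| APar (P Q : aprocess lab var X)
| ARep (P : aprocess lab var X)
| ANil
| ARes (x y : var) (T : X) (P : aprocess lab var X).
Arguments ANil {lab var X}.
Arguments AOut {lab var X} _ _ _.
Arguments AIn {lab var X} _ _ _ _.
Arguments ARes {lab var X} _ _ _ _.

Fixpoint erase (lab var : choiceType) (X : Type) (P : aprocess lab var X)
    : process lab var :=
  match P with
  | AOut x y P => POut x y (erase P)
  | AIn x y _ P => PIn x y (erase P)
  | ABranch x L P => PBranch x (fun l : L => erase (P l))
  | ASel x l P => PSel x l (erase P)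
  | APar P Q => PPar (erase P) (erase Q)
  | ARep P => PRep (erase P)
  | ANil => PNil
  | ARes x y _ P => PRes x y (erase P)
  end.

Definition context (D : Type) (lab var : choiceType)
  (X : sessionCoalgebra D lab) : Type := {fmap var -> X}.
Arguments context {D lab} var X.

(* Since G.[x <- T] overwrites, "G, x:T" is always accompanied below by its
   presupposition x \notin G. *)
Section Typing.
Variables (D : Type) (leD : rel D) (lab var : choiceType).
Variable X : sessionCoalgebra D lab.
Implicit Types (G : context var X) (T U : X) (x y : var) (F : {fset var}).

Definition un T : bool :=
  match sigma T with
  | Par | End | Bsc _ => true
  | Com _ | Branch _ _ => false
  end.

Definition un_ctx G : Prop := forall x T, G.[? x] = Some T -> un T.

(* split G G1 G2 is G = G1 o G2. *)
Inductive split : context var X -> context var X -> context var X -> Prop :=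
| split_nil : split [fmap] [fmap] [fmap]
| split_un G G1 G2 x T :
    split G G1 G2 -> un T ->
    x \notin G -> x \notin G1 -> x \notin G2 ->
    split G.[x <- T] G1.[x <- T] G2.[x <- T]
| split_left G G1 G2 x T :
    split G G1 G2 -> x \notin G -> x \notin G1 ->
    split G.[x <- T] G1.[x <- T] G2
| split_right G G1 G2 x T :
    split G G1 G2 -> x \notin G -> x \notin G2 ->
    split G.[x <- T] G1 G2.[x <- T].

(* ctx_diff G F G' says that the partial difference of G by F is defined and
   equal to G'. *)
Inductive ctx_diff (G : context var X) : {fset var} -> context var X -> Prop :=
| ctx_diff_nil : ctx_diff G fset0 G
| ctx_diff_un F G' x T :
    x \notin G' -> ctx_diff G F G'.[x <- T] -> un T ->
    ctx_diff G (x |` F) G'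
| ctx_diff_notin F G' x :
    ctx_diff G F G' -> x \notin G' ->
    ctx_diff G (x |` F) G'.

Inductive typed : context var X -> process lab var -> Prop :=
| T_Inact G : un_ctx G -> typed G PNil
| T_Res G x y T U P :
    x \notin G -> y \notin G.[x <- T] ->
    typed G.[x <- T].[y <- U] P -> duality leD T U ->
    typed G (PRes x y P)
| T_Par G G1 G2 P Q :
    split G G1 G2 -> typed G1 P -> typed G2 Q -> typed G (PPar P Q)
| T_Rep G P : typed G P -> un_ctx G -> typed G (PRep P)
| T_In G x y T U P (h0 : arity (sigma T) Star) (h1 : arity (sigma T) One) :
    x \notin G -> y \notin G -> x \notin G.[y <- U] ->
    sigma T = Com pin ->
    typed G.[y <- U].[x <- delta T Star h0] P ->
    sim leD (delta T One h1) U ->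
    typed G.[x <- T] (PIn x y P)
| T_Out G x y T U P (h0 : arity (sigma T) Star) (h1 : arity (sigma T) One) :
    x \notin G -> y \notin G.[x <- T] ->
    sigma T = Com pout ->
    typed G.[x <- delta T Star h0] P ->
    sim leD U (delta T One h1) ->
    typed G.[x <- T].[y <- U] (POut x y P)
| T_Branch G x T (L1 L2 : {fset lab}) (P : L2 -> process lab var)
    (sub : L1 `<=` L2) :
    x \notin G ->
    sigma T = Branch pin L1 ->
    (forall (l : L1) (h : arity (sigma T) (Lab (val l))),
       typed G.[x <- delta T (Lab (val l)) h] (P (fincl sub l))) ->
    typed G.[x <- T] (PBranch x P)
| T_Sel G x T (L : {fset lab}) l P (h : arity (sigma T) (Lab l)) :
    x \notin G ->
    sigma T = Branch pout L -> l \in L ->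
    typed G.[x <- delta T (Lab l) h] P ->
    typed G.[x <- T] (PSel x l P)
| T_Unpack G x T P (h : arity (sigma T) Star) :
    x \notin G ->
    sigma T = Par -> parallelizable leD T ->
    typed G.[x <- delta T Star h] P ->
    typed G.[x <- T] P.

Variable dual : X -> option X.

Inductive algo : context var X -> aprocess lab var X -> context var X -> Prop :=
| A_Inact G : algo G ANil G
| A_Rep G1 G2 P : algo G1 P G2 -> G1 = G2 -> algo G1 (ARep P) G2
| A_Par G1 G2 G3 P Q :
    algo G1 P G2 -> algo G2 Q G3 -> algo G1 (APar P Q) G3
| A_Res G1 G2 G3 x y T T' P :
    x \notin G1 -> y \notin G1.[x <- T] ->
    dual T = Some T' ->
    algo G1.[x <- T].[y <- T'] P G2 ->
    ctx_diff G2 [fset x; y] G3 ->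
    algo G1 (ARes x y T P) G3
| A_In G1 G2 G3 x y T U P (h0 : arity (sigma T) Star) (h1 : arity (sigma T) One) :
    x \notin G1 -> y \notin G1 -> x \notin G1.[y <- U] ->
    sigma T = Com pin ->
    sim leD (delta T One h1) U ->
    algo G1.[y <- U].[x <- delta T Star h0] P G2 ->
    ctx_diff G2 [fset x; y] G3 ->
    algo G1.[x <- T] (AIn x y U P) G3
| A_Out G1 G2 G3 x y T U P (h0 : arity (sigma T) Star) (h1 : arity (sigma T) One) :
    x \notin G1 -> y \notin G1.[x <- T] ->
    sigma T = Com pout ->
    sim leD U (delta T One h1) ->
    algo G1.[x <- delta T Star h0] P G2 ->
    ctx_diff G2 [fset x] G3 ->
    algo G1.[x <- T].[y <- U] (AOut x y P) G3
| A_Branch G1 G3 x T (L1 L2 : {fset lab}) (P : L2 -> aprocess lab var X)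
    (sub : L1 `<=` L2) (G2 : L1 -> context var X) :
    x \notin G1 ->
    sigma T = Branch pin L1 ->
    (forall (l : L1) (h : arity (sigma T) (Lab (val l))),
       algo G1.[x <- delta T (Lab (val l)) h] (P (fincl sub l)) (G2 l)) ->
    (forall l : L1, ctx_diff (G2 l) [fset x] G3) ->
    algo G1.[x <- T] (ABranch x P) G3
| A_Sel G1 G2 G3 x T (L : {fset lab}) l P (h : arity (sigma T) (Lab l)) :
    x \notin G1 ->
    sigma T = Branch pout L -> l \in L ->
    algo G1.[x <- delta T (Lab l) h] P G2 ->
    ctx_diff G2 [fset x] G3 ->
    algo G1.[x <- T] (ASel x l P) G3
| A_Unpack G1 G2 G3 x T P (h : arity (sigma T) Star) :
    x \notin G1 ->
    sigma T = Par -> parallelizable leD T ->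
    algo G1.[x <- delta T Star h] P G2 ->
    ctx_diff G2 [fset x] G3 -> x \notin G3 ->
    algo G1.[x <- T] P G3.[x <- T].

End Typing.

(* Main.v *)
(* An algorithmic derivation of [G1 |- P; G2] leaves the linear entries of [G2]
   untouched, so they can be erased from the whole derivation: by induction,
   [G1] without the linear variables of [G2] types [P] declaratively.  For
   parallel composition, the linear variables that [P] leaves are exactly those
   that the split must hand to [Q] alone.  When [G2] is unrestricted nothing is
   erased. *)
Require Import Defs.
From mathcomp Require Import all_boot finmap.

Set Implicit Arguments.
Unset Strict Implicit.
Unset Printing Implicit Defensive.

Local Open Scope fset_scope.
Local Open Scope fmap_scope.

(** * Inclusion, difference, linear variables and splitting of contexts *)

Section Contexts.
Variables (D : Type) (lab var : choiceType) (X : sessionCoalgebra D lab).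
Implicit Types (G H : context var X) (F : {fset var}) (x y : var) (T : X).

Definition sub_ctx G H : Prop :=
  forall x T, G.[? x] = Some T -> H.[? x] = Some T.

Lemma sub_ctx_trans G H K : sub_ctx G H -> sub_ctx H K -> sub_ctx G K.
Proof. by move=> GH HK x T /GH /HK. Qed.

Lemma sub_ctx_notin G H x : sub_ctx G H -> x \notin H -> x \notin G.
Proof.
move=> GH; apply: contraNN => xG.
by rewrite -fndSome (GH x _ (in_fnd xG)).
Qed.

Lemma sub_ctx_set G x T : x \notin G -> sub_ctx G G.[x <- T].
Proof.
by move=> xG y U; rewrite fnd_set; case: eqP => // ->; rewrite not_fnd.
Qed.

Lemma sub_ctx_setl G H x T T' :
  sub_ctx G H.[x <- T] -> x \notin G -> sub_ctx G H.[x <- T'].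
Proof.
move=> GH xG y U Gy; move: (GH _ _ Gy); rewrite !fnd_set.
by case: eqP => // yx; move: Gy; rewrite yx not_fnd.
Qed.

Lemma sub_ctx_strip G H x T : sub_ctx G H.[x <- T] -> x \notin G -> sub_ctx G H.
Proof.
move=> GH xG y U Gy; move: (GH _ _ Gy); rewrite fnd_set.
by case: eqP => // yx; move: Gy; rewrite yx not_fnd.
Qed.

Lemma sub_ctx_setS G H x T : sub_ctx G H -> sub_ctx G.[x <- T] H.[x <- T].
Proof. by move=> GH y U; rewrite !fnd_set; case: eqP => // _ /GH. Qed.

Lemma sub_ctx_rem G F : sub_ctx G.[\ F] G.
Proof. by move=> x T; rewrite fnd_rem; case: ifP. Qed.

(** Replaces the inductive difference by a restriction with a side condition, so that later
    arguments reason by lookup. *)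
Lemma ctx_diffP G F H : ctx_diff G F H ->
  H = G.[\ F] /\ (forall x T, x \in F -> G.[? x] = Some T -> un T).
Proof.
elim=> {F H} [|F H x T xH _ [eH uF] uT|F H x _ [-> uF] xH].
- by rewrite remf0; split=> // x T; rewrite inE.
- split.
    by rewrite fsetUC -remf_comp -eH remf1_set eqxx remf1_id.
  move=> y U; have [yF _ /(uF _ _ yF) //|yF] := boolP (y \in F).
  rewrite !inE (negPf yF) orbF => /eqP -> Gx.
  (* Looking up [x] on both sides of [eH] identifies its type in [G] with the unrestricted [T]. *)
  have := fnd_set H x T x; rewrite eqxx eH fnd_rem Gx.
  by case: ifP => // _ [->].
- split; first by rewrite fsetUC -remf_comp remf1_id.
  move=> y U; have [yF _ /(uF _ _ yF) //|yF] := boolP (y \in F).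
  rewrite !inE (negPf yF) orbF => /eqP yx Gy.
  by move: xH; rewrite mem_remf -yx yF -fndSome Gy.
Qed.

Lemma ctx_diff_sub G F H : ctx_diff G F H -> sub_ctx H G.
Proof. by case/ctx_diffP => -> _; apply: sub_ctx_rem. Qed.

Lemma ctx_diff_notin_dom G F H x : ctx_diff G F H -> x \in F -> x \notin H.
Proof. by case/ctx_diffP => -> _ xF; rewrite mem_remf xF. Qed.

(** The default [true] treats an absent variable as unrestricted, so [in_lin] needs no condition on
    the domain. *)
Definition lin G : {fset var} := [fset x in domf G | ~~ oapp (@un D lab X) true G.[? x]].

Lemma in_lin G x : (x \in lin G) = ~~ oapp (@un D lab X) true G.[? x].
Proof. by rewrite !inE /=; case: fndP. Qed.

Lemma lin_notin G x : x \notin G -> x \notin lin G.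
Proof. by move=> xG; rewrite in_lin not_fnd. Qed.

Lemma lin_sub G H : sub_ctx G H -> lin G `<=` lin H.
Proof.
move=> GH; apply/fsubsetP => x; rewrite !in_lin.
by case E: G.[? x] => [T|] //; rewrite (GH _ _ E).
Qed.

Lemma lin_set_un G x T : un T -> x \notin G -> lin G.[x <- T] = lin G.
Proof.
move=> uT xG; apply/fsetP => y; rewrite !in_lin fnd_set.
by case: eqP => //= ->; rewrite not_fnd //= uT.
Qed.

(** A difference is defined only if the entries it removes are unrestricted. *)
Lemma lin_diff G F H : ctx_diff G F H -> lin G = lin H.
Proof.
case/ctx_diffP => -> uF; apply/fsetP => x; rewrite !in_lin fnd_rem.
by case: ifP => // xF; case E: G.[? x] => [T|] //=; rewrite (uF _ _ xF E).
Qed.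

Lemma un_ctx_lin0 G : un_ctx G -> lin G = fset0.
Proof.
move=> uG; apply/fsetP => x; rewrite in_lin inE.
by case E: G.[? x] => [T|] //=; rewrite (uG _ _ E).
Qed.

Lemma un_ctx_rem_lin G : un_ctx G.[\ lin G].
Proof.
move=> x T; rewrite fnd_rem in_lin; case: ifP => // /negbFE + E.
by rewrite E.
Qed.

(** Builds a split from lookups alone, by induction on [G]: dropping the added variable [x] from
    both halves leaves a split of the smaller context. *)
Lemma splitI G G1 G2 :
  sub_ctx G1 G -> sub_ctx G2 G ->
  (forall x, x \in G -> (x \in G1) || (x \in G2)) ->
  (forall x T, G1.[? x] = Some T -> x \in G2 -> un T) ->
  Defs.split G G1 G2.
Proof.
elim/fmap_rect: G G1 G2 => [|G IH x T xG] G1 G2 s1 s2 cov unI.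
  have nil H : sub_ctx H [fmap] -> H = [fmap].
    move=> sH; apply/fmapP => y; rewrite fnd_fmap0.
    by case E: H.[? y] => [U|] //; have := sH _ _ E; rewrite fnd_fmap0.
  by rewrite (nil _ s1) (nil _ s2); apply: split_nil.
have xr H : x \notin H.[~ x] by rewrite mem_remfF.
have subr H : sub_ctx H G.[x <- T] -> sub_ctx H.[~ x] G.
  by move=> sH; apply: sub_ctx_strip (xr H); apply: sub_ctx_trans sH; apply: sub_ctx_rem.
have put H : sub_ctx H G.[x <- T] -> x \in H -> H = H.[~ x].[x <- T].
  move=> sH xH; rewrite setf_rem1; apply/fmapP => y; rewrite fnd_set.
  case: eqP => // ->; have := in_fnd xH => E; rewrite E.
  by rewrite -(sH _ _ E) fnd_set eqxx.
have rest : Defs.split G G1.[~ x] G2.[~ x].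
  apply: IH; [exact: subr | exact: subr | |].
    move=> y yG; have yx : y != x by apply: contraNneq xG => <-.
    by rewrite !mem_remf1 yx /=; apply: cov; rewrite mem_setf inE /= yG orbT.
  move=> y U; rewrite fnd_rem1 mem_remf1; case: ifP => //= _; exact: unI.
(* Which halves contain [x] decides the constructor; [cov] excludes the case of neither. *)
have := cov x; rewrite mem_setf inE eqxx => /(_ isT).
have [x1|x1] := boolP (x \in G1); have [x2|x2] := boolP (x \in G2) => //= _.
- rewrite (put _ s1 x1) (put _ s2 x2); apply: split_un => //.
  apply: unI x2; rewrite (put _ s1 x1).
  by rewrite fnd_set eqxx.
- rewrite (put _ s1 x1) -(remf1_id x2); exact: split_left.
- rewrite (put _ s2 x2) -(remf1_id x1); exact: split_right.
Qed.

(** Entries outside [H] go left only and the linear ones of [H] not in [F] go right only. A shared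
    variable lies in [H] without being linear there, hence is unrestricted. *)
Lemma split_rem_lin G H F : sub_ctx H G -> F `<=` lin H ->
  Defs.split G.[\ F] G.[\ lin H] H.[\ F].
Proof.
move=> HG FH; apply: splitI.
- move=> x T; rewrite !fnd_rem; case: ifP => // xH.
  by case: ifP => // /(fsubsetP FH); rewrite xH.
- by move=> x T; rewrite !fnd_rem; case: ifP => // _ /HG.
- move=> x; rewrite !mem_remf => /andP[-> xG]; rewrite xG andbT /=.
  by case: (boolP (x \in H)) => [|/lin_notin ->]; rewrite ?orbT.
- move=> x T; rewrite fnd_rem in_lin mem_remf; case: ifP => // /negbFE + Gx /andP[_ xH].
  by rewrite in_fnd //= -(Some_inj (etrans (esym (HG _ _ (in_fnd xH))) Gx)).
Qed.

End Contexts.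

(** * Leftover contexts and erasure of their linear variables *)

Section Soundness.
Variables (D : Type) (leD : rel D) (lab var : choiceType).
Variables (X : sessionCoalgebra D lab) (dual : X -> option X).
Implicit Types (G : context var X) (P : aprocess lab var X).

(** Guarantees that a branching has a premise from which facts about the common leftover can be
    read. *)
Lemma branch_label (T : X) p L : sigma T = Branch p L ->
  exists l : L, arity (sigma T) (Lab (val l)).
Proof.
move=> sT; have /fset0Pn[l lL] := branch_nonempty sT.
by exists [` lL]; rewrite sT.
Qed.

(** A rule that binds a variable or changes its type removes it from the leftover; unpacking then
    restores the original entry. *)
Lemma algo_sub G1 P G2 : algo leD dual G1 P G2 -> sub_ctx G2 G1.
Proof.
elim=> {G1 P G2}.
- by move=> G x T.
- by move=> G1 G2 P _ ? ->.
- by move=> G1 G2 G3 P Q _ s1 _ s2; apply: sub_ctx_trans s1.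
- move=> G1 G2 G3 x y T T' P _ _ _ _ s dG.
  have s3 := sub_ctx_trans (ctx_diff_sub dG) s.
  have nx : x \notin G3 by apply: (ctx_diff_notin_dom dG); rewrite !inE eqxx.
  have ny : y \notin G3 by apply: (ctx_diff_notin_dom dG); rewrite !inE eqxx orbT.
  exact: sub_ctx_strip (sub_ctx_strip s3 ny) nx.
- move=> G1 G2 G3 x y T U P h0 h1 xG yG _ _ _ _ s dG.
  have s3 := sub_ctx_trans (ctx_diff_sub dG) s.
  have nx : x \notin G3 by apply: (ctx_diff_notin_dom dG); rewrite !inE eqxx.
  have ny : y \notin G3 by apply: (ctx_diff_notin_dom dG); rewrite !inE eqxx orbT.
  apply: sub_ctx_trans (sub_ctx_set _ xG).
  exact: sub_ctx_strip (sub_ctx_strip s3 nx) ny.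
- move=> G1 G2 G3 x y T U P h0 h1 xG yG _ _ _ s dG.
  have s3 := sub_ctx_trans (ctx_diff_sub dG) s.
  have nx : x \notin G3 by apply: (ctx_diff_notin_dom dG); rewrite inE.
  apply: sub_ctx_trans (sub_ctx_set _ yG); exact: sub_ctx_setl s3 nx.
- move=> G1 G3 x T L1 L2 P sub G2 _ sT _ s dG.
  have [l hl] := branch_label sT.
  have s3 := sub_ctx_trans (ctx_diff_sub (dG l)) (s l hl).
  have nx : x \notin G3 by apply: (ctx_diff_notin_dom (dG l)); rewrite inE.
  exact: sub_ctx_setl s3 nx.
- move=> G1 G2 G3 x T L l P h _ _ _ _ s dG.
  have s3 := sub_ctx_trans (ctx_diff_sub dG) s.
  have nx : x \notin G3 by apply: (ctx_diff_notin_dom dG); rewrite inE.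
  exact: sub_ctx_setl s3 nx.
- move=> G1 G2 G3 x T P h _ _ _ _ s dG nx.
  have s3 := sub_ctx_trans (ctx_diff_sub dG) s.
  apply: sub_ctx_setS; exact: sub_ctx_strip s3 nx.
Qed.

Hypothesis dualP : dual_function leD dual.

(** Where a rule takes a difference, [lin_diff] makes premise and conclusion erase the same set. The
    variables the rule acts on lie outside it, so erasing commutes with adding them to the
    context. *)
Lemma algo_typed G1 P G2 : algo leD dual G1 P G2 ->
  typed leD G1.[\ lin G2] (erase P).
Proof.
have rem_notin (G : context var X) F x : x \notin G -> x \notin G.[\ F].
  by move=> xG; rewrite mem_remf (negPf xG) andbF.
elim=> {G1 P G2} /=.
- by move=> G; apply/T_Inact/un_ctx_rem_lin.
(* Input and leftover coincide, so the erasure removes every linear entry of the input. *)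
- by move=> G1 G2 P _ + e; rewrite e => IH; apply: (T_Rep IH); exact: un_ctx_rem_lin.
- move=> G1 G2 G3 P Q aP tP aQ tQ; apply: T_Par tP tQ.
  apply: split_rem_lin; [exact: algo_sub aP | exact/lin_sub/algo_sub/aQ].
- move=> G1 G2 G3 x y T T' P xG yG dT _ + dG.
  have nx : x \notin lin G3.
    by apply/lin_notin/(ctx_diff_notin_dom dG); rewrite !inE eqxx.
  have ny : y \notin lin G3.
    by apply/lin_notin/(ctx_diff_notin_dom dG); rewrite !inE eqxx orbT.
  rewrite (lin_diff dG) !remf_set (negPf nx) (negPf ny) => tP.
  apply: T_Res tP (dualP dT); first exact: rem_notin.
  by have := rem_notin _ (lin G3) _ yG; rewrite remf_set (negPf nx).
- move=> G1 G2 G3 x y T U P h0 h1 xG yG xGy sT TU _ + dG.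
  have nx : x \notin lin G3.
    by apply/lin_notin/(ctx_diff_notin_dom dG); rewrite !inE eqxx.
  have ny : y \notin lin G3.
    by apply/lin_notin/(ctx_diff_notin_dom dG); rewrite !inE eqxx orbT.
  rewrite (lin_diff dG) !remf_set (negPf nx) (negPf ny) => tP.
  apply: T_In tP TU => //; [exact: rem_notin | exact: rem_notin |].
  by have := rem_notin _ (lin G3) _ xGy; rewrite remf_set (negPf ny).
- move=> G1 G2 G3 x y T U P h0 h1 xG yG sT UT aP + dG.
  have nx : x \notin lin G3.
    by apply/lin_notin/(ctx_diff_notin_dom dG); rewrite !inE eqxx.
  (* The sent [y] is not in the difference set: it is already missing from the premise's input, and
     leftovers never grow. *)
  have ny : y \notin lin G3.
    apply/lin_notin/(sub_ctx_notin (ctx_diff_sub dG)).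
    apply: sub_ctx_notin (algo_sub aP) _.
    by move: yG; rewrite !mem_setf !inE.
  rewrite (lin_diff dG) !remf_set (negPf nx) (negPf ny) => tP.
  apply: T_Out tP UT => //; first exact: rem_notin.
  by have := rem_notin _ (lin G3) _ yG; rewrite remf_set (negPf nx).
- move=> G1 G3 x T L1 L2 P sub G2 xG sT _ tP dG.
  have nx : x \notin lin G3.
    have [l _] := branch_label sT.
    by apply/lin_notin/(ctx_diff_notin_dom (dG l)); rewrite inE.
  rewrite remf_set (negPf nx); apply: (T_Branch (sub := sub)) => //.
    exact: rem_notin.
  move=> l h; have := tP l h.
  by rewrite (lin_diff (dG l)) remf_set (negPf nx).
- move=> G1 G2 G3 x T L l P h xG sT lL _ + dG.
  have nx : x \notin lin G3.
    by apply/lin_notin/(ctx_diff_notin_dom dG); rewrite inE.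
  rewrite (lin_diff dG) !remf_set (negPf nx) => tP.
  by apply: T_Sel sT lL tP; apply: rem_notin.
- move=> G1 G2 G3 x T P h xG sT pT _ + dG xG3.
  have nx := lin_notin xG3.
  (* The restored [x] has a [Par] type, which is unrestricted and so is not erased. *)
  rewrite lin_set_un //; last by rewrite /un sT.
  rewrite (lin_diff dG) !remf_set (negPf nx) => tP.
  by apply: T_Unpack sT pT tP; apply: rem_notin.
Qed.

End Soundness.

Theorem theorem6 (D : Type) (leD : rel D)
    (leD_refl : reflexive leD) (leD_trans : transitive leD)
    (lab var : choiceType) (X : sessionCoalgebra D lab)
    (dual : X -> option X) (dualP : dual_function leD dual)
    (G1 G2 : context var X) (P : aprocess lab var X) :
  algo leD dual G1 P G2 -> un_ctx G2 -> typed leD G1 (erase P).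
Proof.
by move=> /(algo_typed dualP) + /un_ctx_lin0 e; rewrite e remf0.
Qed.
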